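(* Let $Y$ be a real random variable with infinitely divisible distribution $\mu$, all of whose moments $\mu_n$ are finite, and with characteristic function of the form $\exp\{i\theta a+\int_0^\infty(e^{i\theta z}-1)\,d\nu(z)\}$. For $t\in\mathbf{R}_+$ let $Y_t$ be a random variable with characteristic function $\exp\{t[i\theta a+\int_0^\infty(e^{i\theta z}-1)\,d\nu(z)]\}$. Then the Maxwell-Boltzmann $\mu^{\circ t}$ is the law of the L\'evy process $Y_t$, in the sense of moments: for every $t\in\mathbf{R}_+$ and every integer $n\ge1$, $\mathbf{E}[(Y_t)^n]=\mu^{\circ t}_n$.
   Context: For a probability measure $\mu$ with all moments $\mu_n$ finite, $t\in\mathbf{R}_+$ and $n\ge1$, the Maxwell-Boltzmann $\mu^{\circ t}_n$ is defined as $$\mu^{\circ t}_n=\sum_{j=1}^{n}\binom{t}{j}\sum_{n_1=1}^{n}\cdots\sum_{n_j=1}^{n}\chi_{(n_1+\cdots+n_j=n)}\frac{n!}{n_1!\cdots n_j!}\prod_{i=1}^{j}\mu_{n_i},$$ where $\binom{t}{j}=\frac{t(t-1)\cdots(t-j+1)}{j!}$ and $\chi_{(n_1+\cdots+n_j=n)}$ equals $1$ if $n_1+\cdots+n_j=n$ and $0$ otherwise. $\mu^{\circ t}$ denotes the class of measures having these moments (it need not be a single measure). *)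

(* Defs.v *)
From HB Require Import structures.
From mathcomp Require Import all_boot all_order all_algebra.
From mathcomp Require Import all_classical all_reals all_analysis.
From mathcomp Require Import complex.

Set Implicit Arguments.
Unset Strict Implicit.
Unset Printing Implicit Defensive.

Import Order.TTheory GRing.Theory Num.Theory.
Import numFieldNormedType.Exports.

Local Open Scope classical_set_scope.
Local Open Scope ring_scope.
Local Open Scope complex_scope.

Section ComplexAnalysis.
Context {R : realType}.

(* exp (x + i y) = e^x (cos y + i sin y) *)
Definition cexp (z : R[i]) : R[i] :=
  (expR (complex.Re z) * cos (complex.Im z))
    +i* (expR (complex.Re z) * sin (complex.Im z)).

(* cintegral takes a default value (through fine) when f is not integrable, so
   statements using it with an infinite measure have to assume cintegrable. *)
Definition cintegrable d (T : measurableType d)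
    (mu : {measure set T -> \bar R}) (D : set T) (f : T -> R[i]) : Prop :=
  mu.-integrable D (fun x => (complex.Re (f x))%:E) /\
  mu.-integrable D (fun x => (complex.Im (f x))%:E).

Definition cintegral d (T : measurableType d)
    (mu : {measure set T -> \bar R}) (D : set T) (f : T -> R[i]) : R[i] :=
  (\int[mu]_(x in D) complex.Re (f x)) +i* (\int[mu]_(x in D) complex.Im (f x)).

Definition char_fun d (T : measurableType d) (P : probability T R)
    (X : {RV P >-> R}) (theta : R) : R[i] :=
  cintegral P setT (fun w => cexp ('i%C * (theta * X w)%:C)).

End ComplexAnalysis.

Section InfinitelyDivisible.
Context {R : realType}.
Implicit Types mu : probability R R.

Definition real_add (x : R * R) : R := x.1 + x.2.

Lemma measurable_real_add : measurable_fun setT real_add.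
Proof. exact: measurable_realfun.measurable_funD. Qed.

HB.instance Definition _ :=
  isMeasurableFun.Build _ _ _ _ real_add measurable_real_add.

Definition convolution mu1 mu2 : probability R R :=
  distribution (mu1 \x mu2)%E real_add.

Fixpoint conv_power mu n : probability R R :=
  if n is k.+1 then convolution mu (conv_power mu k)
  else dirac (0 : R).

Definition infinitely_divisible mu : Prop :=
  forall n, (0 < n)%N ->
  exists mu_n : probability R R,
  forall A : set R, measurable A ->
    conv_power mu_n n A = mu A.

End InfinitelyDivisible.

Section MaxwellBoltzmann.
Context {R : realType}.
Implicit Types (mu : probability R R) (t : R) (n : nat).

Definition all_moments_finite mu : Prop :=
  forall n, mu.-integrable setT (fun x => (x ^+ n)%:E).

Definition moment mu n : R := \int[mu]_x (x ^+ n).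

Definition gbinom t j : R := (\prod_(i < j) (t - i%:R)) / j`!%:R.

(* The j indices n_1, ..., n_j in {1, ..., n} are encoded by k : 'I_j -> 'I_n
   with n_i = (k i).+1; the indicator of n_1 + ... + n_j = n is the filter of
   the inner sum. *)
Definition maxwell_boltzmann mu t n : R :=
  \sum_(1 <= j < n.+1) gbinom t j *
    \sum_(k : {ffun 'I_j -> 'I_n} | (\sum_i (k i).+1 == n)%N)
      n`!%:R / (\prod_i (k i).+1`!)%N%:R * \prod_i moment mu (k i).+1.

End MaxwellBoltzmann.

(* i theta a + \int_0^oo (e^(i theta z) - 1) d nu(z), so that the values of nu
   outside ]0, +oo[ are irrelevant. *)
Definition levy_exponent {R : realType} (a : R)
    (nu : {measure set R -> \bar R}) (theta : R) : R[i] :=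
  'i%C * (theta * a)%:C +
  cintegral nu `]0, +oo[ (fun z : R => cexp ('i%C * (theta * z)%:C) - 1).

(* Main.v *)
(* Let phi and psi be the characteristic function and the exponent of Y, so
   that phi = exp psi and Y_t has characteristic function exp (t psi). Near 0
   the function psi is O(x), so exp (t psi) = sum_j binom(t,j) (phi - 1)^j up
   to any order, and the Taylor expansion of phi in the moments of Y gives one
   of exp (t psi). Central differences turn that expansion into the finiteness
   of the even moments of Y_t, hence of all its moments; they are then read off
   by comparing coefficients, and expanding (phi - 1)^j gives the multinomial
   sum. That psi is O(x) follows from the bound of |Im psi(2x) - 2 Im psi(x)|
   by -2 Re psi(x), which forces the winding number of Im psi to vanish near
   0. *)
Require Import Defs.
From mathcomp Require Import all_boot all_order all_algebra.
From mathcomp Require Import all_classical all_reals all_analysis.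
From mathcomp Require Import complex zify ring lra measurable_realfun.

Set Implicit Arguments.
Unset Strict Implicit.
Unset Printing Implicit Defensive.

Import Order.TTheory GRing.Theory Num.Theory.
Import numFieldNormedType.Exports.

Local Open Scope classical_set_scope.
Local Open Scope ring_scope.
Local Open Scope complex_scope.

(** * Taylor expansion of the complex exponential *)

Section ComplexNorm1.
Context {R : realType}.
Implicit Types (x y : R) (z w u : R[i]).

(* Equivalent to the modulus, submultiplicative, and R-valued. *)
Definition norm1 z : R := `|complex.Re z| + `|complex.Im z|.

Lemma norm1_ge0 z : 0 <= norm1 z.
Proof. by rewrite addr_ge0. Qed.

Lemma norm1_eq0 z : norm1 z = 0 -> z = 0.
Proof.
move/eqP; case: z => a b; rewrite /norm1 /= paddr_eq0 // !normr_eq0.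
by move=> /andP[/eqP-> /eqP->].
Qed.

Lemma norm1N z : norm1 (- z) = norm1 z.
Proof. by case: z => a b; rewrite /norm1 /= !normrN. Qed.

Lemma norm1_real x : norm1 x%:C = `|x|.
Proof. by rewrite /norm1 /= normr0 addr0. Qed.

Lemma norm1D z w : norm1 (z + w) <= norm1 z + norm1 w.
Proof.
by case: z w => a b [c e]; rewrite /norm1 /= addrACA lerD ?ler_normD.
Qed.

Lemma norm1M z w : norm1 (z * w) <= norm1 z * norm1 w.
Proof.
case: z w => a b [c e]; rewrite /norm1 /= !mulrDl !mulrDr -!normrM.
have := ler_normB (a * c) (b * e); have := ler_normD (a * e) (b * c).
by lra.
Qed.

Lemma norm1Z x z : norm1 (x%:C * z) = `|x| * norm1 z.
Proof.
by case: z => a b; rewrite /norm1 /= !mul0r subr0 addr0 !normrM mulrDr.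
Qed.

Lemma norm1_iM z : norm1 ('i%C * z) = norm1 z.
Proof.
by case: z => a b; rewrite /norm1 /= !mul0r !mul1r sub0r add0r normrN addrC.
Qed.

Lemma ler_norm1_Re z : `|complex.Re z| <= norm1 z.
Proof. by rewrite lerDl. Qed.

Lemma ler_norm1_Im z : `|complex.Im z| <= norm1 z.
Proof. by rewrite lerDr. Qed.

Lemma ReD z w : complex.Re (z + w) = complex.Re z + complex.Re w.
Proof. by case: z w => ? ? [? ?]. Qed.

Lemma ImD z w : complex.Im (z + w) = complex.Im z + complex.Im w.
Proof. by case: z w => ? ? [? ?]. Qed.

Lemma ReN z : complex.Re (- z) = - complex.Re z.
Proof. by case: z. Qed.

Lemma ImN z : complex.Im (- z) = - complex.Im z.
Proof. by case: z. Qed.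

Lemma Re_realM x z : complex.Re (x%:C * z) = x * complex.Re z.
Proof. by case: z => a b /=; rewrite mul0r subr0. Qed.

End ComplexNorm1.

Section CexpTaylor.
Context {R : realType}.
Implicit Types (x y s : R) (z w u : R[i]).

Lemma cexp0 : cexp (0 : R[i]) = 1.
Proof. by rewrite /cexp /= expR0 cos0 sin0 mulr1 mulr0. Qed.

Lemma cexpD z w : cexp (z + w) = cexp z * cexp w.
Proof.
case: z w => a b [c e]; rewrite /cexp /= expRD cosD sinD.
by apply/eqP; rewrite eq_complex /=; apply/andP; split; apply/eqP; ring.
Qed.

Lemma cexp_i x : cexp ('i%C * x%:C) = cos x +i* sin x.
Proof. by rewrite /cexp /= !mul0r !mul1r subrr expR0 !mul1r add0r. Qed.

Lemma cexpMn z n : cexp (n%:R * z) = cexp z ^+ n.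
Proof.
elim: n => [|n IHn]; first by rewrite mul0r cexp0 expr0.
by rewrite -natr1 mulrDl mul1r cexpD IHn exprSr.
Qed.

Definition cexp_rem n w : R[i] := cexp w - \sum_(m < n) m`!%:R^-1 * w ^+ m.

Lemma is_derive_Re_cexp u w s :
  is_derive s 1 (fun s : R => complex.Re (u * cexp (s%:C * w)))
    (complex.Re (u * w * cexp (s%:C * w))).
Proof.
case: u w => p q [a b].
have -> : (fun s : R => complex.Re ((p +i* q) * cexp (s%:C * (a +i* b)))) =
    (fun s => expR (s * a) * (p * cos (s * b) - q * sin (s * b))).
  apply/funext => r; rewrite /cexp /= !mul0r subr0 addr0; ring.
rewrite /cexp /= !mul0r subr0 addr0.
apply: trigger_derive; rewrite /GRing.scale /=.
ring.
Qed.

Lemma Re_cexp_rem_deriv n u w s :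
  is_derive s 1 (fun s : R => complex.Re (u * cexp_rem n.+1 (s%:C * w)))
    (complex.Re (u * w * cexp_rem n (s%:C * w))).
Proof.
elim: n => [|n IHn].
  have -> : (fun s : R => complex.Re (u * cexp_rem 1 (s%:C * w))) =
     (fun s => complex.Re (u * cexp (s%:C * w))) - cst (complex.Re u).
    apply/funext => r; rewrite /cexp_rem big_ord1 expr0 fact0 invr1 mulr1.
    by rewrite mulrBr mulr1 ReD ReN.
  rewrite /cexp_rem big_ord0 !subr0.
  have H := is_derive_Re_cexp u w s.
  by apply: trigger_derive; rewrite subr0.
pose c := complex.Re (u * w ^+ n.+1).
have -> : (fun s : R => complex.Re (u * cexp_rem n.+2 (s%:C * w))) =
   (fun s => complex.Re (u * cexp_rem n.+1 (s%:C * w)))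
   - (fun s => (n.+1`!%:R^-1 * c) * s ^+ n.+1).
  apply/funext => r; rewrite /cexp_rem big_ord_recr /= opprD addrA mulrDr ReD.
  congr (_ + _); rewrite mulrN ReN; congr (- _).
  have -> : u * (n.+1`!%:R^-1 * (r%:C * w) ^+ n.+1) =
     (n.+1`!%:R^-1 * r ^+ n.+1)%:C * (u * w ^+ n.+1).
    by rewrite exprMn rmorphM rmorphXn /= rmorphV ?unitfE ?pnatr_eq0 -?lt0n
       ?fact_gt0 // rmorph_nat; ring.
  by rewrite Re_realM mulrAC.
have -> : complex.Re (u * w * cexp_rem n.+1 (s%:C * w)) =
  complex.Re (u * w * cexp_rem n (s%:C * w)) - n`!%:R^-1 * c * s ^+ n.
  rewrite {1}/cexp_rem big_ord_recr /= opprD addrA mulrDr ReD.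
  congr (_ + _); rewrite mulrN ReN; congr (- _).
  have -> : u * w * (n`!%:R^-1 * (s%:C * w) ^+ n) =
     (n`!%:R^-1 * s ^+ n)%:C * (u * w ^+ n.+1).
    by rewrite exprMn exprS rmorphM rmorphXn /= rmorphV ?unitfE ?pnatr_eq0
       -?lt0n ?fact_gt0 // rmorph_nat; ring.
  by rewrite Re_realM mulrAC.
have D : is_derive s 1 (fun s : R => n.+1`!%:R^-1 * c * s ^+ n.+1)
    (n`!%:R^-1 * c * s ^+ n).
  have -> : (fun s : R => n.+1`!%:R^-1 * c * s ^+ n.+1) =
      (n.+1`!%:R^-1 * c) \*: (@id R) ^+ n.+1.
    by apply/funext => r /=; rewrite fctE.
  apply: (is_derive_eq (is_deriveZ _ (is_deriveX n.+1 (is_derive_id s 1)))).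
  rewrite /GRing.scale /= mulr1 factS natrM.
  by field; rewrite nat1r !pnatr_eq0 -!lt0n fact_gt0.
exact: is_deriveB.
Qed.

Lemma norm1_cexp w : complex.Re w <= 1 -> norm1 (cexp w) <= 2 * expR 1.
Proof.
case: w => a b /= a1; rewrite /norm1 /cexp /= !normrM !(ger0_norm (expR_ge0 _)).
rewrite mulr2n mulrDl mul1r; apply: lerD; rewrite -[leRHS]mulr1.
  by apply: ler_pM; rewrite ?expR_ge0 ?ler_expR ?cos_max.
by apply: ler_pM; rewrite ?expR_ge0 ?ler_expR ?sin_max.
Qed.

(** Induction on [n] with [u] generalized: the remainder of order [n.+1] vanishes at [s = 0], and by
    the mean value theorem it is controlled by the one of order [n] with [u * w] in place of [u].
    Only the real part of [w] is constrained, so [w] may be any purely imaginary number. *)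
Lemma Re_cexp_rem_bound n u w : complex.Re w <= 1 -> forall s, 0 <= s <= 1 ->
  `|complex.Re (u * cexp_rem n (s%:C * w))|
    <= 2 * expR 1 * norm1 u * norm1 w ^+ n.
Proof.
move=> w1; elim: n u => [|n IHn] u s /andP[s0 s1].
  rewrite /cexp_rem big_ord0 subr0 expr0 mulr1.
  apply: le_trans (ler_norm1_Re _) _; apply: le_trans (norm1M _ _) _.
  rewrite mulrC ler_wpM2r ?norm1_ge0 // norm1_cexp // Re_realM.
  by have [w0|/ltW w0] := leP 0 (complex.Re w); nra.
have D r := Re_cexp_rem_deriv n u w r.
have [|c cs] := @MVT_segment R _ _ 0 s s0 (fun x _ => D x).
  apply: continuous_subspaceT => x.
  by apply/differentiable_continuous/derivable1_diffP; case: (D x).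
have -> : cexp_rem n.+1 (0%:C * w) = 0.
  rewrite /cexp_rem mul0r cexp0 big_ord_recl expr0 fact0 invr1 mulr1.
  by rewrite big1 ?addr0 ?subrr // => i _; rewrite expr0n mulr0.
rewrite mulr0 /= subr0 subr0 => ->.
rewrite normrM (ger0_norm s0) -[leRHS]mulr1; apply: ler_pM => //.
have /IHn : 0 <= c <= 1.
  by move: cs; rewrite in_itv /= => /andP[-> /le_trans->].
move=> /(_ (u * w)) /le_trans; apply.
rewrite exprS mulrA ler_wpM2r ?exprn_ge0 ?norm1_ge0 // -!mulrA.
by rewrite !ler_wpM2l ?expR_ge0 ?ler0n // norm1M.
Qed.

Lemma norm1_cexp_rem n w : complex.Re w <= 1 ->
  norm1 (cexp_rem n w) <= 4 * expR 1 * norm1 w ^+ n.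
Proof.
move=> w1; have s1 : 0 <= (1 : R) <= 1 by rewrite ler01 lexx.
(* The multipliers [1] and [- 'i] yield the real and imaginary parts; adding the two bounds gives
   the constant [4 * expR 1]. *)
have := Re_cexp_rem_bound n 1 w1 s1.
have := Re_cexp_rem_bound n (- 'i%C) w1 s1.
rewrite mul1r norm1N (norm1_real 1) normr1 (mul1r w).
have -> : norm1 ('i%C : R[i]) = 1 by rewrite /norm1 /= normr0 normr1 add0r.
have -> : complex.Re (- 'i%C * cexp_rem n w) = complex.Im (cexp_rem n w).
  by case: (cexp_rem n w) => a b /=; rewrite oppr0 mul0r sub0r mulN1r opprK.
by rewrite /norm1 !mulr1; lra.
Qed.

End CexpTaylor.

(** * Expansions at 0 up to a given order *)

Section BigO.
Context {R : realType}.
Implicit Types (f g h : R -> R[i]) (p q : {poly R[i]}) (n m k : nat).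

(** The neighbourhood contains 0 itself, so for positive [n] this forces [f 0 = 0]. *)
Definition bigO n f : Prop :=
  exists C : R, \forall x \near (0 : R), norm1 (f x) <= C * `|x| ^+ n.

Lemma bigO_near n f g :
  (\forall x \near (0 : R), f x = g x) -> bigO n f -> bigO n g.
Proof. by move=> fg [C fC]; exists C; apply: filterS2 fg fC => x ->. Qed.

Lemma eq_bigO n f g : f =1 g -> bigO n f -> bigO n g.
Proof. by move=> fg; apply: bigO_near; near=> x; exact: fg.
Unshelve. all: by end_near. Qed.

Lemma bigO_cst (c : R[i]) : bigO 0 (fun=> c).
Proof. by exists (norm1 c); near=> x; rewrite expr0 mulr1.
Unshelve. all: by end_near. Qed.

Lemma bigO0 n : bigO n (fun=> 0).
Proof. by exists 0; near=> x; rewrite mul0r norm1_real normr0.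
Unshelve. all: by end_near. Qed.

Lemma bigO_id : bigO 1 (fun x => x%:C).
Proof. by exists 1; near=> x; rewrite expr1 mul1r norm1_real.
Unshelve. all: by end_near. Qed.

Lemma bigOD n f g : bigO n f -> bigO n g -> bigO n (fun x => f x + g x).
Proof.
move=> [C fC] [D gD]; exists (C + D); apply: filterS2 fC gD => x fC gD.
by rewrite mulrDl; apply: le_trans (norm1D _ _) _; exact: lerD.
Qed.

Lemma bigON n f : bigO n f -> bigO n (fun x => - f x).
Proof. by move=> [C fC]; exists C; apply: filterS fC => x; rewrite norm1N. Qed.

Lemma bigOB n f g : bigO n f -> bigO n g -> bigO n (fun x => f x - g x).
Proof. by move=> fO /bigON; exact: bigOD. Qed.

Lemma bigOM n m f g :
  bigO n f -> bigO m g -> bigO (n + m) (fun x => f x * g x).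
Proof.
move=> [C fC] [D gD]; exists (C * D); apply: filterS2 fC gD => x fC gD.
apply: le_trans (norm1M _ _) _; rewrite exprD mulrACA.
by apply: ler_pM; rewrite ?norm1_ge0.
Qed.

Lemma bigOZ n (c : R[i]) f : bigO n f -> bigO n (fun x => c * f x).
Proof. by move=> fO; rewrite -[n]add0n; exact: bigOM (bigO_cst c) fO. Qed.

Lemma bigOW n m f : (m <= n)%N -> bigO n f -> bigO m f.
Proof.
move=> mn [C fC]; exists `|C|.
apply: filterS2 (nbhs0_le ltr01) fC => x x1 /le_trans; apply.
apply: le_trans (_ : `|C| * `|x| ^+ n <= _).
  by rewrite ler_wpM2r ?exprn_ge0 // ler_norm.
by rewrite ler_wpM2l // ler_wiXn2l.
Qed.

Lemma bigO_sum (I : Type) (s : seq I) (P : pred I) n (F : I -> R -> R[i]) :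
  (forall i, P i -> bigO n (F i)) ->
  bigO n (fun x => \sum_(i <- s | P i) F i x).
Proof.
move=> FO; elim: s => [|i s IHs].
  by apply: eq_bigO (bigO0 n) => x; rewrite big_nil.
have [Pi|nPi] := boolP (P i).
  by apply: eq_bigO (bigOD (FO _ Pi) IHs) => x; rewrite big_cons Pi.
by apply: eq_bigO IHs => x; rewrite big_cons (negbTE nPi).
Qed.

Lemma bigOX n k f : bigO n f -> bigO (n * k) (fun x => f x ^+ k).
Proof.
move=> fO; elim: k => [|k IHk]; first by rewrite muln0; exact: bigO_cst.
by rewrite mulnS; apply: eq_bigO (bigOM fO IHk) => x; rewrite exprS.
Qed.

Lemma bigO_scale n f (r : R) : bigO n f -> bigO n (fun x => f (r * x)).
Proof.
move=> [C fC]; exists (C * `|r| ^+ n).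
have : (fun x : R => r * x) @ (0 : R) --> (r * 0 : R).
  exact: mulrl_continuous.
rewrite mulr0 => rc.
have : \forall x \near (0 : R), norm1 (f (r * x)) <= C * `|r * x| ^+ n.
  exact: rc _ fC.
apply: filterS => x.
by rewrite normrM exprMn mulrA.
Qed.

Lemma bigO_horner p f : bigO 0 f -> bigO 0 (fun x => p.[f x]).
Proof.
move=> fO; elim/poly_ind: p => [|p c IHp].
  by apply: eq_bigO (bigO0 0) => x; rewrite horner0.
apply: eq_bigO (bigOD (bigOM IHp fO) (bigO_cst c)) => x.
by rewrite hornerMXaddC.
Qed.

(** Telescoping along the Horner scheme: p(f) f - p(g) g = (p(f) - p(g)) g + p(f) (f - g). *)
Lemma bigOB_horner n p f g : bigO 0 f -> bigO 0 g ->
  bigO n (fun x => f x - g x) -> bigO n (fun x => p.[f x] - p.[g x]).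
Proof.
move=> fO gO fgO; elim/poly_ind: p => [|p c IHp].
  by apply: eq_bigO (bigO0 n) => x; rewrite !horner0 subrr.
have := bigOM (bigO_horner p fO) fgO; have := bigOM IHp gO.
rewrite addn0 add0n => H1 H2; apply: eq_bigO (bigOD H1 H2) => x.
by rewrite !hornerMXaddC; ring.
Qed.

Lemma bigO_low_coef0 n p f : bigO 1 f -> (forall i, (i < n)%N -> p`_i = 0) ->
  bigO n (fun x => p.[f x]).
Proof.
move=> fO p0; have -> : p = drop_poly n p * 'X^n.
  rewrite -[LHS](poly_take_drop n) -[RHS]add0r; congr (_ + _).
  apply/polyP => i; rewrite coef_take_poly coef0.
  by case: ifP => // /p0.
have := bigOM (bigO_horner (drop_poly n p) (bigOW (leq0n 1) fO)) (bigOX n fO).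
by rewrite add0n mul1n; apply: eq_bigO => x; rewrite hornerM hornerXn.
Qed.

Lemma dnbhs_bigO1_cst0 (c : R[i]) (C : R) :
  (\forall x \near (0 : R)^', norm1 c <= C * `|x|) -> c = 0.
Proof.
move=> cC; apply: norm1_eq0; apply/eqP; rewrite eq_le norm1_ge0 andbT.
apply/ler_addgt0Pr => e e0; rewrite add0r.
have C0 : 0 < `|C| + 1 by rewrite ltr_wpDl.
have xe : \forall x \near (0 : R)^', `|x| <= e / (`|C| + 1).
  apply: (nbhs_dnbhs (nbhs0_le _)); by rewrite divr_gt0.
have [x [xC]] := filter_ex (filterI cC xe).
rewrite ler_pdivlMr // => xe'; apply: le_trans xC _.
apply: le_trans xe'; rewrite mulrC ler_wpM2l //.
by apply: le_trans (ler_norm C) _; rewrite lerDl.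
Qed.

(** Uniqueness of Taylor coefficients. Once the lower coefficients vanish, p = q X^n; dividing by
    x^n away from 0 gives q(x) = O(x), and q(x) - q(0) = O(x) always holds, so the constant q(0) is
    O(x), hence 0. *)
Lemma bigO_coef0 n p : bigO n (fun x => p.[x%:C]) ->
  forall i, (i < n)%N -> p`_i = 0.
Proof.
elim: n => // n IHn pO i.
have {}IHn := IHn (bigOW (leqnSn n) pO).
rewrite ltnS leq_eqVlt => /predU1P[->{i}|]; last exact: IHn.
pose q := drop_poly n p.
have pE : p = q * 'X^n.
  rewrite -[LHS](poly_take_drop n) -[RHS]add0r; congr (_ + _).
  by apply/polyP => i; rewrite coef_take_poly coef0; case: ifP => // /IHn.
have [C pC] := pO.
have [D qD] : bigO 1 (fun x => (q - (q`_0)%:P).[x%:C]).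
  apply: bigO_low_coef0; first exact: bigO_id.
  by case=> // _; rewrite coefB coefC eqxx subrr.
have -> : p`_n = q`_0 by rewrite coef_drop_poly add0n.
apply: (@dnbhs_bigO1_cst0 _ (C + D)).
have x0 : \forall x \near (0 : R)^', x != 0 by exact: nbhs_dnbhs_neq.
apply: filterS3 x0 (nbhs_dnbhs pC) (nbhs_dnbhs qD) => x x0.
have -> : p.[x%:C] = (x ^+ n)%:C * q.[x%:C].
  by rewrite [in LHS]pE hornerM hornerXn mulrC rmorphXn.
rewrite norm1Z normrX exprSr mulrCA ler_pM2l ?exprn_gt0 ?normr_gt0 // => qC.
rewrite hornerD hornerN hornerC => qD'.
have -> : q`_0 = q.[x%:C] - (q.[x%:C] - q`_0) by rewrite opprB addrC subrK.
apply: le_trans (norm1D _ _) _; rewrite norm1N mulrDl.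
by apply: lerD => //; move: qD'; rewrite expr1.
Qed.

End BigO.

(** * Truncated exponential and binomial series *)

Section ExpPoly.
Context {R : realType}.
Implicit Types (f : R -> R[i]) (c : R[i]) (t : R) (n i j r : nat).

Lemma bigO_cexp n c f : bigO 1 f ->
  bigO n (fun x => cexp_rem n (c * f x)).
Proof.
move=> fO; have cfO := bigOZ c fO; have [C fC] := cfO.
(* On this radius C |x| <= 1, so the argument of the exponential has real part at most 1 and the
   remainder bound applies. *)
have C1 : 0 < (`|C| + 1)^-1 by rewrite invr_gt0 ltr_wpDl.
exists (4 * expR 1 * C ^+ n); apply: filterS2 (nbhs0_le C1) fC => x x1.
rewrite expr1 => xC.
have le1 : norm1 (c * f x) <= 1.
  apply: le_trans xC _; apply: le_trans (_ : (`|C| + 1) * `|x| <= _).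
    by rewrite ler_wpM2r // (le_trans (ler_norm C)) // lerDl.
  by rewrite mulrC -ler_pdivlMr ?mul1r // ltr_wpDl.
have Re1 : complex.Re (c * f x) <= 1.
  exact: le_trans (ler_norm _) (le_trans (ler_norm1_Re _) le1).
apply: le_trans (norm1_cexp_rem n Re1) _.
rewrite -[leRHS]mulrA -exprMn ler_wpM2l ?mulr_ge0 ?expR_ge0 //.
by rewrite lerXn2r ?nnegrE ?norm1_ge0 // (le_trans (norm1_ge0 _) xC).
Qed.

Definition exp_poly n c : {poly R[i]} := \poly_(m < n) (m`!%:R^-1 * c ^+ m).

Lemma bigO_cexp_exp_poly n c f : bigO 1 f ->
  bigO n (fun x => cexp (c * f x) - (exp_poly n c).[f x]).
Proof.
move=> /(bigO_cexp n c); apply: eq_bigO => x; rewrite /cexp_rem horner_poly.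
by congr (_ - _); apply: eq_bigr => m _; rewrite exprMn mulrA.
Qed.

Lemma bigO0_cexp f : bigO 1 f -> bigO 0 (fun x => cexp (f x)).
Proof.
move=> /(bigO_cexp 0 1); apply: eq_bigO => x.
by rewrite /cexp_rem big_ord0 subr0 mul1r.
Qed.

(** Since e^(rx) is the [r]-th power of e^x, [exp_poly n 1 ^+ r] and [exp_poly n r%:R] approximate
    the same function up to order [n], and uniqueness of coefficients applies. *)
Lemma coef_exp_poly_exp n r i : (i < n)%N ->
  (exp_poly n 1 ^+ r)`_i = i`!%:R^-1 * r%:R ^+ i.
Proof.
move=> ilt; have idO := @bigO_id R.
have EO := bigO_cexp_exp_poly n 1 idO.
have ErO := bigO_cexp_exp_poly n r%:R idO.
have cO : bigO 0 (fun x : R => cexp (1 * x%:C)).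
  exact/bigO0_cexp/(bigOZ 1 idO).
have e0 : bigO 0 (fun x : R => (exp_poly n 1).[x%:C]).
  exact: bigO_horner (bigOW (leq0n 1) idO).
have /(bigO_coef0) : bigO n (fun x =>
    (exp_poly n 1 ^+ r - exp_poly n r%:R).[x%:C]).
  apply: eq_bigO (bigOB ErO (bigOB_horner 'X^r cO e0 EO)) => x.
  rewrite !hornerXn mul1r cexpMn !hornerE; ring.
move=> /(_ _ ilt) /eqP; rewrite coefB subr_eq0 => /eqP ->.
by rewrite coef_poly ilt.
Qed.

Lemma gbinom_nat r j : gbinom (r%:R : R) j = 'C(r, j)%:R.
Proof.
rewrite /gbinom; have -> : \prod_(i < j) ((r%:R : R) - i%:R) = (r ^_ j)%:R.
  elim: j => [|j IHj]; first by rewrite big_ord0 ffactn0.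
  rewrite big_ord_recr /= IHj ffactnSr natrM.
  (* For [r < j] the subtraction in the naturals truncates, but the falling factorial is already
     0. *)
  have [jr|rj] := leqP j r; first by rewrite natrB.
  by rewrite ffact_small // !mul0r.
by rewrite -bin_ffact natrM mulfK // pnatr_eq0 -lt0n fact_gt0.
Qed.

(** Truncation of the binomial series of X^t around X = 1. *)
Definition binom_poly n t : {poly R[i]} :=
  \sum_(j < n) (gbinom t j)%:C *: ('X - 1) ^+ j.

Lemma binom_poly_nat n r : (r < n)%N -> binom_poly n r%:R = 'X^r.
Proof.
move=> rn; rewrite -[in RHS](subrK 1 'X) addrC exprDn.
rewrite (big_ord_widen n
  (fun i => 1 ^+ (r - i) * ('X - 1) ^+ i *+ 'C(r, i))) //.
rewrite big_mkcond /=; apply: eq_bigr => j _.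
rewrite gbinom_nat expr1n mul1r rmorph_nat scaler_nat.
by case: ltnP => // /bin_small ->.
Qed.

(* Both sides are polynomials in [t] of degree less than [n] that agree for
   the naturals [t < n]. *)
Lemma coef_binom_poly_exp n t i : (i < n)%N ->
  (binom_poly n t \Po exp_poly n 1)`_i = i`!%:R^-1 * t%:C ^+ i.
Proof.
move=> ilt.
have coefE s : (binom_poly n s \Po exp_poly n 1)`_i =
    \sum_(j < n) (gbinom s j)%:C * (('X - 1) ^+ j \Po exp_poly n 1)`_i.
  rewrite /binom_poly linear_sum coef_sum /=; apply: eq_bigr => j _.
  by rewrite comp_polyZ coefZ.
(* [G j] is the binomial coefficient as a polynomial in its upper argument, so that [D] evaluates at
   [s] to the difference of the two sides. *)
pose G j : {poly R[i]} := j`!%:R^-1 *: \prod_(l < j) ('X - l%:R%:P).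
have GE s j : (gbinom s j)%:C = (G j).[s%:C].
  rewrite /gbinom hornerZ horner_prod mulrC rmorphM rmorphV ?unitfE
    ?pnatr_eq0 -?lt0n ?fact_gt0 //= rmorph_nat rmorph_prod; congr (_ * _).
  by apply: eq_bigr => l _; rewrite !hornerE rmorphB rmorph_nat.
pose D : {poly R[i]} :=
  \sum_(j < n) (('X - 1) ^+ j \Po exp_poly n 1)`_i *: G j - i`!%:R^-1 *: 'X^i.
have DE s : D.[s%:C] =
    (binom_poly n s \Po exp_poly n 1)`_i - i`!%:R^-1 * s%:C ^+ i.
  rewrite hornerD hornerN hornerZ hornerXn coefE horner_sum; congr (_ - _).
  by apply: eq_bigr => j _; rewrite hornerZ GE mulrC.
suff D0 : D = 0 by apply/eqP; rewrite -subr_eq0 -DE D0 horner0.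
apply: (@roots_geq_poly_eq0 _ _ [seq j%:R | j <- iota 0 n]).
- apply/allP => _ /mapP[r + ->]; rewrite mem_iota /= add0n => rn.
  have -> : r%:R = (r%:R : R)%:C by rewrite rmorph_nat.
  rewrite /root DE binom_poly_nat // comp_Xn_poly coef_exp_poly_exp //.
  by rewrite rmorph_nat subrr.
- by rewrite map_inj_uniq ?iota_uniq // => x y /eqP; rewrite eqr_nat => /eqP.
- rewrite size_map size_iota; apply: leq_trans (size_polyD _ _) _.
  rewrite geq_max size_polyN; apply/andP; split.
    apply: leq_trans (size_sum _ _ _) _; apply/bigmax_leqP => j _.
    apply: leq_trans (size_scale_leq _ _) _.
    apply: leq_trans (size_scale_leq _ _) _.
    by rewrite -big_enum size_prod_XsubC size_enum_ord.
  by apply: leq_trans (size_scale_leq _ _) _; rewrite size_polyXn.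
Qed.

(** Replace both exponentials by truncated series in [f]. The two resulting polynomials have the
    same coefficients below [n], so at [f] = O(x) they differ by O(x^n). No complex power or
    logarithm is involved. *)
Lemma bigO_cexp_binom n t f : bigO 1 f ->
  bigO n (fun x => cexp (t%:C * f x) - (binom_poly n t).[cexp (f x)]).
Proof.
move=> fO; have f0 := bigOW (leq0n 1) fO.
have EtO := bigO_cexp_exp_poly n t%:C fO.
have cE : bigO n (fun x => cexp (f x) - (exp_poly n 1).[f x]).
  by apply: eq_bigO (bigO_cexp_exp_poly n 1 fO) => x; rewrite mul1r.
have BO := bigOB_horner (binom_poly n t) (bigO0_cexp fO)
  (bigO_horner (exp_poly n 1) f0) cE.
have H : bigO n (fun x =>
    (binom_poly n t \Po exp_poly n 1 - exp_poly n t%:C).[f x]).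
  apply: bigO_low_coef0 => // i ilt.
  by rewrite coefB coef_binom_poly_exp // coef_poly ilt subrr.
apply: eq_bigO (bigOB (bigOB EtO BO) H) => x.
by rewrite hornerD hornerN horner_comp; ring.
Qed.

End ExpPoly.

(** * Central differences *)

Section CentralDifference.
Context {R : realType}.
Implicit Types (f : R -> R[i]) (c : R[i]) (n m l : nat) (x : R).

(** The nodes (n - 2l) x are symmetric around 0 with spacing 2x, which avoids half-integers. *)
Definition cdiff n f x : R[i] :=
  \sum_(l < n.+1) (-1) ^+ l * 'C(n, l)%:R * f ((n%:R - l%:R *+ 2) * x).

Lemma cdiff_cexp n c x :
  cdiff n (fun y => cexp (c * y%:C)) x =
  (cexp (c * x%:C) - cexp (- (c * x%:C))) ^+ n.
Proof.
rewrite exprBn; apply: eq_bigr => l _.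
rewrite -!cexpMn -[in RHS](mulrA _ (cexp _)) -cexpD -[in RHS]mulrnAl.
rewrite -[in RHS]mulr_natr; congr (_ * cexp _).
rewrite natrB; last by rewrite -ltnS.
rewrite rmorphM rmorphB !rmorphMn rmorph1; ring.
Qed.

(** Up to the factor m!, these sums are the Taylor coefficients of (e^x - e^(-x))^n, which is
    O(x^n). *)
Lemma alternating_binomial_sum n m : (m < n)%N ->
  \sum_(l < n.+1) (-1) ^+ l * 'C(n, l)%:R * (n%:R - l%:R *+ 2)%:C ^+ m
    = 0 :> R[i].
Proof.
move=> mn; have idO := @bigO_id R.
pose p : {poly R[i]} := \sum_(l < n.+1)
  ((-1) ^+ l * 'C(n, l)%:R) *: exp_poly n (n%:R - l%:R *+ 2)%:C.
have sO : bigO n (fun x : R => (cexp (1 * x%:C) - cexp (-1 * x%:C)) ^+ n).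
  rewrite -[n in bigO n]mul1n; apply: bigOX.
  apply: eq_bigO (bigOB (bigO_cexp 1 1 idO) (bigO_cexp 1 (-1) idO)) => x.
  by rewrite /cexp_rem !big_ord1 !expr0; ring.
have pO : bigO n (fun x => p.[x%:C]).
  have eO (l : 'I_n.+1) : true -> bigO n (fun x : R =>
     (-1) ^+ l * 'C(n, l)%:R * (cexp ((n%:R - l%:R *+ 2)%:C * x%:C)
       - (exp_poly n (n%:R - l%:R *+ 2)%:C).[x%:C])).
    by move=> _; apply/bigOZ/bigO_cexp_exp_poly.
  apply: eq_bigO (bigOB sO (bigO_sum (index_enum _) eO)) => x.
  rewrite mulNr -cdiff_cexp /p horner_sum /cdiff -sumrB.
  by apply: eq_bigr => l _; rewrite hornerZ mul1r rmorphM; ring.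
have := bigO_coef0 pO mn; rewrite coef_sum => p0.
apply: (mulfI (_ : m`!%:R^-1 != 0)).
  by rewrite invr_eq0 pnatr_eq0 -lt0n fact_gt0.
rewrite mulr0 -[RHS]p0 mulr_sumr; apply: eq_bigr => l _.
by rewrite coefZ coef_poly mn mulrCA.
Qed.

(** The difference annihilates the monomials of [p] of degree below [n]; the other monomials and the
    rescaled remainders are O(x^n) by themselves. *)
Lemma bigO_cdiff n f (p : {poly R[i]}) :
  bigO n (fun x => f x - p.[x%:C]) -> bigO n (cdiff n f).
Proof.
move=> fO; pose d l : R := n%:R - l%:R *+ 2.
have dO (l : 'I_n.+1) : true -> bigO n (fun x =>
    (-1) ^+ l * 'C(n, l)%:R * (f (d l * x) - p.[(d l * x)%:C])).
  by move=> _; apply/bigOZ/(bigO_scale (d l) fO).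
have mO (m : 'I_(size p)) : true -> bigO n (fun x =>
    (\sum_(l < n.+1) (-1) ^+ l * 'C(n, l)%:R * (d l)%:C ^+ m)
      * (p`_m * x%:C ^+ m)).
  move=> _; have [mn|nm] := ltnP m n.
    by apply: eq_bigO (bigO0 n) => x; rewrite alternating_binomial_sum ?mul0r.
  do 2 apply: bigOZ; apply: (bigOW nm).
  by have := bigOX m (@bigO_id R); rewrite mul1n.
apply: eq_bigO (bigOD (bigO_sum (index_enum _) dO)
  (bigO_sum (index_enum _) mO)) => x.
under [X in _ + X]eq_bigr do rewrite mulr_suml.
rewrite exchange_big -big_split; apply: eq_bigr => l _ /=.
rewrite mulrBr horner_coef.
have -> : \sum_(i < size p) (-1) ^+ l * 'C(n, l)%:R * (d l)%:C ^+ i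
   * (p`_i * x%:C ^+ i) = (-1) ^+ l * 'C(n, l)%:R *
   \sum_(i < size p) p`_i * (d l * x)%:C ^+ i.
  by rewrite mulr_sumr; apply: eq_bigr => i _; rewrite rmorphM exprMn; ring.
by rewrite subrK.
Qed.

End CentralDifference.

(** * The exponent is linearly bounded near 0 *)

Section Winding.
Context {R : realType}.
Implicit Types (x y b : R) (k : int).

Lemma cos_per b k : cos (b + k%:~R * (pi *+ 2)) = cos b.
Proof.
have per n c : cos (c + n%:R * (pi *+ 2)) = cos c :> R.
  by rewrite mulr_natl periodicn //; exact: cosD2pi.
case: k => n; first by rewrite -pmulrn per.
by rewrite NegzE mulrNz mulNr -[LHS](per n.+1) -pmulrn subrK.
Qed.

Lemma cos_gt0_ltr_pihalf b : `|b| <= pi -> 0 < cos b -> `|b| < pi / 2.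
Proof.
move=> bpi cb; rewrite -ltr_cos ?in_itv /= ?normr_ge0 ?bpi ?pi_ge0 //.
  rewrite cos_pihalf; case: (ger0P b) => // _; by rewrite cosN.
by rewrite divr_ge0 ?pi_ge0 //= ler_pdivrMr // ler_peMr ?pi_ge0 // ler1n.
Qed.

(** Write sin b = 2 cos(b/2) sin(b/2) and sin(b/2) = cos(c) b/2 with c in [0, b/2]. Both cosines are
    at least 1/2, because cos(2c) >= 0 there. *)
Lemma sin_ge_quarter b : 0 <= b <= pi / 2 -> b / 4 <= sin b.
Proof.
move=> /andP[b0 bpi].
have b20 : 0 <= b / 2 by rewrite divr_ge0.
have pi0 := @pi_ge0 R.
have cos_half (c : R) : 0 <= c <= b / 2 -> 2^-1 <= cos c.
  move=> /andP[c0 cb].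
  have c1 : 0 <= cos c by apply: cos_ge0_pihalf; apply/andP; split; lra.
  have : 0 <= cos (c *+ 2).
    by apply: cos_ge0_pihalf; rewrite (mulr2n c); apply/andP; split; lra.
  by rewrite cos_mulr2n => ?; nra.
have [|c cb] :=
  @MVT_segment R sin cos 0 (b / 2) b20 (fun x _ => is_derive_sin x).
  exact/continuous_subspaceT/continuous_sin.
rewrite sin0 !subr0 => sinE.
have c2 : 2^-1 <= cos c by apply: cos_half; move: cb; rewrite in_itv.
have b2 : 2^-1 <= cos (b / 2) by apply: cos_half; rewrite b20 lexx.
have -> : sin b = 2 * (cos (b / 2) * sin (b / 2)).
  by rewrite mulr_natl -sin_mulr2n; congr sin; rewrite -[RHS]mulr_natr divfK.
have cc : 4^-1 <= cos (b / 2) * cos c.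
  by rewrite (_ : 4^-1 = 2^-1 * 2^-1) ?ler_pM //; field.
rewrite sinE; have := ler_wpM2r b0 cc; lra.
Qed.

Lemma norm_sin_ge b : `|b| <= pi / 2 -> `|b| / 4 <= `|sin b|.
Proof.
move=> bpi; apply: le_trans (sin_ge_quarter _) _; first by rewrite normr_ge0.
by case: (ger0P b) => _; rewrite ?sinN ?ler_norm // -normrN ler_norm.
Qed.

(** Iterated halving makes [k x] divisible by every power of 2. The power with exponent m = |k x|
    exceeds m, so m = 0. *)
Lemma halving_int_eq0 (d : R) (k : R -> int) :
  (forall x, `|x| < d -> k x = (k (x / 2) *+ 2)) ->
  forall x, `|x| < d -> k x = 0.
Proof.
move=> kE x xd; apply/eqP; rewrite -absz_eq0; apply/eqP.
have E n y : `|y| < d -> exists j : int, k y = j *+ 2 ^ n.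
  elim: n y => [|n IHn] y yd; first by exists (k y).
  have [|j kj] := IHn (y / 2).
    have := normr_ge0 y; rewrite normrM (ger0_norm (_ : 0 <= 2^-1)) //; lra.
  by exists j; rewrite kE // kj -mulrnA expnSr.
set m := `|k x|%N; have [j kj] := E m x xd.
have mE : m = (`|j| * 2 ^ m)%N by rewrite {1}/m kj -mulr_natr abszM natz.
have := ltn_expl m (isT : (1 < 2)%N).
case: `|j|%N mE => [|i] mE; first by rewrite mE mul0n.
by rewrite [X in (X < _)%N]mE ltnNge leq_pmull.
Qed.

(* The winding number [k x] of [Im (psi x)] around [0] is forced to satisfy
   [k (2 x) = 2 (k x)] near [0], hence vanishes: continuity of [psi] is not
   needed. *)
Lemma bigO_of_cexp (psi : R -> R[i]) :
  (forall x, `|complex.Im (psi (2 * x)) - 2 * complex.Im (psi x)|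
     <= - (2 * complex.Re (psi x))) ->
  bigO 1 (fun x => cexp (psi x) - 1) -> bigO 1 psi.
Proof.
(* The constant 10 is 2 + 8: the real part is bounded by 2 C |x| and the imaginary part by 8 C
   |x|. *)
move=> psi2 [C phiC]; exists (10 * C).
(* This radius ensures C |x| <= 1/8. *)
have C80 : 0 < (8 * (`|C| + 1))^-1 by rewrite invr_gt0 mulr_gt0 // ltr_wpDl.
have xsmall : \forall x \near (0 : R), `|x| <= (8 * (`|C| + 1))^-1.
  exact: nbhs0_le.
have [d /= d0 dP] := nbhs_norm0P.1 (filterI phiC xsmall).
have {dP} phi_small x : `|x| < d ->
    norm1 (cexp (psi x) - 1) <= C * `|x| /\ C * `|x| <= 8^-1.
  move=> xd; have [H1 H2] := dP x xd.
  split; first by move: H1; rewrite expr1.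
  apply: le_trans (_ : (`|C| + 1) * (8 * (`|C| + 1))^-1 <= _).
    apply: le_trans (_ : (`|C| + 1) * `|x| <= _).
      by rewrite ler_wpM2r // (le_trans (ler_norm C)) // lerDl.
    by rewrite ler_wpM2l // addr_ge0.
  by rewrite invfM mulrCA divff ?mulr1 // gt_eqF // ltr_wpDl.
pose r x := complex.Re (psi x); pose b x := complex.Im (psi x).
have r_le0 x : r x <= 0.
  have := le_trans (normr_ge0 _) (psi2 x); rewrite -/(r x); lra.
have est x : `|x| < d -> [/\ - r x <= 2 * (C * `|x|), 0 < cos (b x),
    1 - C * `|x| <= expR (r x) & expR (r x) * `|sin (b x)| <= C * `|x|].
  move=> /phi_small[H1 H2].
  have := le_trans (ler_norm1_Re _) H1; have := le_trans (ler_norm1_Im _) H1.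
  rewrite ImD ReD ImN ReN /cexp /= oppr0 addr0 -/(r x) -/(b x).
  rewrite normrM (ger0_norm (expR_ge0 _)) => Him /ler_normlP[+ _].
  rewrite opprB => Hre.
  have e0 := expR_gt0 (r x); have c1 := cos_le1 (b x).
  have cb : 0 < cos (b x) by rewrite -(pmulr_rgt0 _ e0); lra.
  have elow : 1 - C * `|x| <= expR (r x).
    have : expR (r x) * cos (b x) <= expR (r x) by rewrite ler_piMr // ltW.
    by lra.
  split=> //.
  (* From 1 - r <= e^(-r) follows -r e^r <= 1 - e^r <= C |x|, and e^r is at least 1/2. *)
  have := expR_ge1Dx (- r x); rewrite expRN => er.
  have : (1 - r x) * expR (r x) <= 1 by rewrite -ler_pdivlMr // mul1r.
  have := r_le0 x; nra.
pose tau : R := pi *+ 2; have tau0 : 0 < tau by rewrite pmulrn_lgt0 // pi_gt0.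
(* The shift by [pi] centres the reduced angle [b'] in [-pi, pi]. *)
pose k x := Num.floor ((b x + pi) / tau).
pose b' x := b x - (k x)%:~R * tau.
have b'E x : b x = b' x + (k x)%:~R * tau by rewrite subrK.
have b'pi x : `|b' x| <= pi.
  have /andP[] := floor_itv ((b x + pi) / tau).
  rewrite -/(k x) intrD ler_pdivlMr // ltr_pdivrMr // mulrDl mul1r => k1 k2.
  have tauE : tau = pi + pi by rewrite /tau mulr2n.
  by rewrite /b' ler_norml; apply/andP; split; lra.
have b'half x : `|x| < d -> `|b' x| < pi / 2.
  move=> /est[_ + _ _]; rewrite b'E cos_per.
  exact: cos_gt0_ltr_pihalf.
have d2 x : `|x| < d -> `|x / 2| < d.
  move=> xd; have := normr_ge0 x.
  by rewrite normrM (ger0_norm (_ : 0 <= 2^-1)) //; lra.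
have k0 x : `|x| < d -> k x = 0.
  apply: halving_int_eq0 => {}x xd; have x2d := d2 _ xd.
  have := psi2 (x / 2).
  rewrite mulrC divfK // -/(b x) -/(b (x / 2)) -/(r (x / 2)).
  have [rx _ _ _] := est _ x2d; have [_ small] := phi_small _ x2d.
  have := b'half _ xd; have := b'half _ x2d.
  have pi2 := @pi_ge2 R.
  rewrite (b'E x) (b'E (x / 2)) => h1 h2 h3.
  have tauE : tau = pi + pi by rewrite /tau mulr2n.
  (* The three contributions are |b(x) - 2 b(x/2)| <= 1/2, |b'(x)| < pi/2 and 2 |b'(x/2)| < pi;
     their sum is below 2 pi since pi >= 2. An integer multiple of 2 pi this small is 0. *)
  have /ltr_normlP[e1 e2] : `|(k x - k (x / 2) *+ 2)%:~R * tau| < tau.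
    rewrite intrB mulr2n intrD.
    by move: h1 h2 h3 => /ltr_normlP[? ?] /ltr_normlP[? ?] /ler_normlP[? ?];
      apply/ltr_normlP; split; lra.
  apply/eqP; rewrite -subr_eq0; move: e1 e2; rewrite -mulNr -intrN.
  rewrite !gtr_pMl // -[1]/(1%:~R) !ltr_int; lia.
have e10 x : `|x| < d -> norm1 (psi x) <= 10 * C * `|x| ^+ 1.
  move=> xd; have [rx cb elow esin] := est x xd.
  have [_ small] := phi_small x xd.
  have := b'half x xd; rewrite /b' k0 // mul0r subr0 => /ltW /norm_sin_ge bsin.
  rewrite /norm1 -/(r x) -/(b x) expr1 (ler0_norm (r_le0 x)).
  have : 2^-1 * `|sin (b x)| <= expR (r x) * `|sin (b x)|.
    by rewrite ler_wpM2r //; lra.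
  by lra.
by apply/nbhs_norm0P; exists d.
Qed.

End Winding.

(** * Complex integrals and characteristic functions *)

Section ComplexIntegral.
Context {R : realType} d (T : measurableType d).
Variables (mu : {measure set T -> \bar R}) (D : set T) (mD : measurable D).
Implicit Types (f g : T -> R[i]) (h : T -> R) (c : R[i]).

Lemma integrableZl_EFin (r : R) h : mu.-integrable D (EFin \o h) ->
  mu.-integrable D (EFin \o (fun x => r * h x)).
Proof.
by move=> hi; apply: eq_integrable (integrableZl mD r hi) => // x _ /=.
Qed.

Lemma eq_cintegrable f g : f =1 g -> cintegrable mu D f -> cintegrable mu D g.
Proof. by move=> /funext ->. Qed.

Lemma cintegrableD f g : cintegrable mu D f -> cintegrable mu D g ->
  cintegrable mu D (fun x => f x + g x).
Proof.
move=> [f1 f2] [g1 g2]; split.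
  by apply: eq_integrable (integrableD mD f1 g1) => // x _; rewrite ReD.
by apply: eq_integrable (integrableD mD f2 g2) => // x _; rewrite ImD.
Qed.

Lemma cintegralD f g : cintegrable mu D f -> cintegrable mu D g ->
  cintegral mu D (fun x => f x + g x) = cintegral mu D f + cintegral mu D g.
Proof.
move=> [f1 f2] [g1 g2]; rewrite /cintegral.
under eq_Rintegral do rewrite ReD.
under [X in _ +i* X = _]eq_Rintegral do rewrite ImD.
by rewrite !RintegralD.
Qed.

Lemma cintegrableZ c f : cintegrable mu D f ->
  cintegrable mu D (fun x => c * f x).
Proof.
case: c => p q [f1 f2]; split.
  apply: eq_integrable (integrableB mD (integrableZl mD p f1)
    (integrableZl mD q f2)) => // x _.
  by case: (f x) => a b.
apply: eq_integrable (integrableD mD (integrableZl mD p f2)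
  (integrableZl mD q f1)) => // x _.
by case: (f x) => a b.
Qed.

Lemma cintegralZ c f : cintegrable mu D f ->
  cintegral mu D (fun x => c * f x) = c * cintegral mu D f.
Proof.
case: c => p q [f1 f2]; rewrite /cintegral.
have ReM x : complex.Re ((p +i* q) * f x) =
  p * complex.Re (f x) - q * complex.Im (f x) by case: (f x).
have ImM x : complex.Im ((p +i* q) * f x) =
  p * complex.Im (f x) + q * complex.Re (f x) by case: (f x).
under eq_Rintegral do rewrite ReM.
under [X in _ +i* X = _]eq_Rintegral do rewrite ImM.
have Z1 r : mu.-integrable D (EFin \o (fun x => r * complex.Re (f x))).
  exact: integrableZl_EFin f1.
have Z2 r : mu.-integrable D (EFin \o (fun x => r * complex.Im (f x))).
  exact: integrableZl_EFin f2.
by rewrite RintegralB // RintegralD // !RintegralZl.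
Qed.

Lemma cintegrable_sum (I : Type) (s : seq I) (F : I -> T -> R[i]) :
  (forall i, cintegrable mu D (F i)) ->
  cintegrable mu D (fun x => \sum_(i <- s) F i x).
Proof.
move=> Fi; elim: s => [|i s IHs].
  split; apply: eq_integrable (integrable0 mu D) => // x _; by rewrite big_nil.
by apply: eq_cintegrable (cintegrableD (Fi i) IHs) => x; rewrite big_cons.
Qed.

Lemma cintegral_sum (I : Type) (s : seq I) (F : I -> T -> R[i]) :
  (forall i, cintegrable mu D (F i)) ->
  cintegral mu D (fun x => \sum_(i <- s) F i x) =
  \sum_(i <- s) cintegral mu D (F i).
Proof.
move=> Fi; elim: s => [|i s IHs].
  rewrite big_nil /cintegral.
  under eq_Rintegral do rewrite big_nil.
  under [X in _ +i* X = _]eq_Rintegral do rewrite big_nil.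
  by rewrite /Rintegral !integral0.
rewrite big_cons -IHs -cintegralD //; last exact: cintegrable_sum.
by congr cintegral; apply/funext => x; rewrite big_cons.
Qed.

Lemma cintegrable_real h : mu.-integrable D (fun x => (h x)%:E) ->
  cintegrable mu D (fun x => (h x)%:C).
Proof. by move=> hi; split=> //; exact: integrable0. Qed.

Lemma cintegral_real h :
  cintegral mu D (fun x => (h x)%:C) = (\int[mu]_(x in D) h x)%:C.
Proof.
by apply/eqP; rewrite eq_complex /= eqxx /= /Rintegral integral0.
Qed.

Lemma norm1_cintegral_le f h : cintegrable mu D f ->
  mu.-integrable D (fun x => (h x)%:E) ->
  (forall x, D x -> norm1 (f x) <= h x) ->
  norm1 (cintegral mu D f) <= \int[mu]_(x in D) h x.
Proof.
move=> [f1 f2] hi fh; rewrite /norm1 /=.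
apply: le_trans (lerD (le_normr_Rintegral mD f1) (le_normr_Rintegral mD f2)) _.
have n1 := integrable_norm f1; have n2 := integrable_norm f2.
rewrite -RintegralD //; apply: le_Rintegral => //.
exact: (integrableD mD n1 n2).
Qed.

End ComplexIntegral.

(** The linear drift cancels, and |sin 2y - 2 sin y| = 2 (1 - cos y) |sin y| <= 2 (1 - cos y) is
    integrated against [nu]; the right-hand side integrates to -2 Re psi. *)
Lemma levy_exponent_double (R : realType) (a : R)
    (nu : {measure set R -> \bar R}) :
  (forall theta : R, cintegrable nu `]0, +oo[
     (fun z : R => cexp ('i%C * (theta * z)%:C) - 1)) ->
  forall x, `|complex.Im (levy_exponent a nu (2 * x))
    - 2 * complex.Im (levy_exponent a nu x)|
    <= - (2 * complex.Re (levy_exponent a nu x)).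
Proof.
move=> nui x; have mD : measurable (`]0, +oo[ : set R) by [].
pose F y z : R[i] := cexp ('i%C * (y * z)%:C) - 1.
have [c1 s1] := nui x; have [_ s2] := nui (2 * x).
rewrite -/(F x) in c1 s1; rewrite -/(F (2 * x)) in s2.
have ImE y : complex.Im (levy_exponent a nu y) =
    y * a + \int[nu]_(z in `]0, +oo[) complex.Im (F y z).
  by rewrite /levy_exponent ImD; congr (_ + _); rewrite /= mul0r mul1r add0r.
have ReE y : complex.Re (levy_exponent a nu y) =
    \int[nu]_(z in `]0, +oo[) complex.Re (F y z).
  by rewrite /levy_exponent ReD /= mul0r mul1r subrr add0r.
rewrite !ImE ReE {ImE ReE}.
set I1 := \int[nu]_(_ in _) _; set I2 := \int[nu]_(_ in _) _.
have -> : 2 * x * a + I1 - 2 * (x * a + I2) = I1 - 2 * I2 by ring.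
have s1' := integrableZl_EFin mD 2 s1.
rewrite {}/I1 {}/I2 -(RintegralZl _ mD s1) -RintegralB //.
have i0 := integrableB mD s2 s1'.
apply: le_trans (le_normr_Rintegral mD i0) _.
rewrite -mulNr -(RintegralZl _ mD c1); apply: le_Rintegral => //.
- exact: integrable_norm i0.
- exact: (integrableZl_EFin mD (- 2) c1).
move=> z _; rewrite /F !cexp_i /= oppr0 !addr0 -mulrA.
set s := sin (x * z); set c := cos (x * z).
have -> : sin (2 * (x * z)) - 2 * s = (2 * (1 - c)) * - s.
  by rewrite (mulr_natl (x * z)) sin_mulr2n -/s -/c -mulr_natl; ring.
have c1' : 0 <= 2 * (1 - c) by rewrite mulr_ge0 // subr_ge0 cos_le1.
rewrite normrM normrN (ger0_norm c1') mulNr -mulrN opprB -[leRHS]mulr1.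
by rewrite ler_wpM2l // sin_max.
Qed.

(** * Characteristic functions and moments of a random variable *)

Section CharFun.
Context {R : realType} d (T : measurableType d) (P : probability T R).
Variable X : {RV P >-> R}.
Implicit Types (theta h : R) (n k m : nat).

Lemma measurable_RV_scale h : measurable_fun setT (fun w => h * X w).
Proof. by apply: measurable_funM => //; exact: measurable_funP. Qed.

Lemma cintegrable_char_fun theta :
  cintegrable P setT (fun w => cexp ('i%C * (theta * X w)%:C)).
Proof.
have bounded_int (g : R -> R) : (forall x, `|g x| <= 1) -> continuous g ->
    P.-integrable setT (fun w => (g (theta * X w))%:E).
  move=> g1 gc; apply: measurable_bounded_integrable => //.
  - exact: le_lt_trans (probability_le1 P measurableT) (ltry 1).
  - apply: measurableT_comp; first exact: continuous_measurable_fun.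
    exact: measurable_RV_scale.
  - exists 1; split=> // y y1 w _ /=; exact: le_trans (g1 _) (ltW y1).
split; [have := bounded_int cos (@cos_max R) (@continuous_cos R)
  | have := bounded_int sin (@sin_max R) (@continuous_sin R)];
  by apply: eq_integrable => // w _; rewrite cexp_i.
Qed.

Definition moment_poly n (mu : nat -> R) : {poly R[i]} :=
  \poly_(m < n) (m`!%:R^-1 * 'i%C ^+ m * (mu m)%:C).

(** Integrate the Taylor remainder of the exponential at i theta X. Its argument has real part 0, so
    the bound by the [n]-th absolute moment holds for every theta, and the radius 1 below is
    arbitrary. *)
Lemma bigO_char_fun n :
  (forall m, P.-integrable setT (fun w => (X w ^+ m)%:E)) ->
  bigO n (fun theta => char_fun X theta
    - (moment_poly n (fun m => \int[P]_w (X w ^+ m))).[theta%:C]).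
Proof.
move=> Xint.
have absint : P.-integrable setT (EFin \o (fun w => `|X w| ^+ n)).
  by have := integrable_norm (Xint n); apply: eq_integrable => // w _ /=;
    rewrite normrX.
exists (4 * expR 1 * \int[P]_w (`|X w| ^+ n)).
apply/nbhs_norm0P; exists 1 => //= theta _.
pose c m : R[i] := - (m`!%:R^-1 * 'i%C ^+ m * theta%:C ^+ m).
have ci m : cintegrable P setT (fun w => c m * (X w ^+ m)%:C).
  by apply: cintegrableZ => //; exact: cintegrable_real.
have cs := cintegrable_sum measurableT (index_enum 'I_n) (fun i : 'I_n => ci i).
have -> : char_fun X theta
    - (moment_poly n (fun m => \int[P]_w (X w ^+ m))).[theta%:C] =
    cintegral P setT (fun w => cexp_rem n ('i%C * (theta * X w)%:C)).
  rewrite horner_poly -sumrN.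
  transitivity (char_fun X theta + cintegral P setT
      (fun w => \sum_(m < n) c m * (X w ^+ m)%:C)).
    rewrite (cintegral_sum measurableT _ (fun i : 'I_n => ci i)).
    congr (_ + _); apply: eq_bigr => m _.
    rewrite cintegralZ //; last exact: cintegrable_real.
    by rewrite cintegral_real /c; ring.
  rewrite -cintegralD //; last exact: cintegrable_char_fun.
  congr cintegral; apply/funext => w; rewrite /cexp_rem -sumrN.
  congr (_ + _); apply: eq_bigr => m _.
  by rewrite /c !rmorphM rmorphXn !exprMn /=; ring.
have -> : 4 * expR 1 * (\int[P]_w (`|X w| ^+ n)) * `|theta| ^+ n =
    \int[P]_w (4 * expR 1 * `|theta| ^+ n * `|X w| ^+ n).
  by rewrite RintegralZl //; ring.
apply: norm1_cintegral_le => //.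
- apply: eq_cintegrable
    (cintegrableD measurableT (cintegrable_char_fun theta) cs).
  move=> w; rewrite /cexp_rem -sumrN.
  congr (_ + _); apply: eq_bigr => m _.
  by rewrite /c !rmorphM rmorphXn !exprMn /=; ring.
- exact: (integrableZl_EFin _ _ absint).
- move=> w _; apply: le_trans (norm1_cexp_rem _ _) _.
    by rewrite /= mul0r mul1r subrr.
  by rewrite norm1_iM norm1_real normrM exprMn mulrA.
Qed.

Lemma integrable_sinX h n :
  P.-integrable setT (EFin \o (fun w => sin (h * X w) ^+ n)).
Proof.
apply: measurable_bounded_integrable => //.
- exact: le_lt_trans (probability_le1 P measurableT) (ltry 1).
- apply: measurable_funX.
  apply: (measurableT_comp (continuous_measurable_fun (@continuous_sin R))).
  exact: measurable_RV_scale.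
- exists 1; split=> // y y1 w _ /=.
  by rewrite normrX (le_trans _ (ltW y1)) // exprn_ile1 // sin_max.
Qed.

Lemma cexp_i_sub x :
  cexp ('i%C * x%:C) - cexp (- ('i%C * x%:C)) = 2 * 'i%C * (sin x)%:C :> R[i].
Proof.
rewrite -mulrN -rmorphN !cexp_i cosN sinN; apply/eqP; rewrite eq_complex /=.
by apply/andP; split; apply/eqP; ring.
Qed.

(** By linearity the difference passes under the expectation, where it turns e^(i h X) into (2 i
    sin(h X))^(2k). *)
Lemma cdiff_char_fun k h : cdiff (2 * k) (char_fun X) h =
  ((-4) ^+ k * \int[P]_w (sin (h * X w) ^+ (2 * k)))%:C.
Proof.
pose c l : R[i] := (-1) ^+ l * 'C(2 * k, l)%:R.
pose e l : R := ((2 * k)%:R - l%:R *+ 2) * h.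
have ci l : cintegrable P setT
    (fun w => c l * cexp ('i%C * (e l * X w)%:C)).
  by apply: cintegrableZ => //; exact: cintegrable_char_fun.
have sinE (y : R) : ((-4) ^+ k * sin y ^+ (2 * k))%:C =
    (cexp ('i%C * y%:C) - cexp (- ('i%C * y%:C))) ^+ (2 * k).
  rewrite cexp_i_sub !exprM -exprMn rmorphXn /=; congr (_ ^+ _).
  rewrite rmorphM rmorphXn !exprMn sqr_i rmorphN rmorph_nat /=; ring.
transitivity (cintegral P setT (fun w =>
    \sum_(l < (2 * k).+1) c l * cexp ('i%C * (e l * X w)%:C))).
  rewrite (cintegral_sum measurableT _ (fun l : 'I_(2 * k).+1 => ci l)).
  apply: eq_bigr => l _; rewrite cintegralZ //; exact: cintegrable_char_fun.
transitivity (cintegral P setT (fun w =>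
    ((-4) ^+ k * sin (h * X w) ^+ (2 * k))%:C)).
  congr cintegral; apply/funext => w; rewrite sinE -cdiff_cexp.
  by apply: eq_bigr => l _; rewrite /e mulrA.
by rewrite cintegral_real RintegralZl //; exact: integrable_sinX.
Qed.

(* On [{|X| <= m}] the even moment is controlled by the central difference of
   step [1/m], since [|sin y| >= |y|/4] for [|y| <= 1]. *)
Lemma integrable_even_moment k : bigO (2 * k) (cdiff (2 * k) (char_fun X)) ->
  P.-integrable setT (fun w => (X w ^+ (2 * k))%:E).
Proof.
move=> [C /nbhs_norm0P[e /= e0 eP]].
have pow0 (x : R) : 0 <= x ^+ (2 * k) by rewrite exprM exprn_ge0 // sqr_ge0.
have sinC h : `|h| < e ->
    \int[P]_w (sin (h * X w) ^+ (2 * k)) <= C * h ^+ (2 * k).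
  have sin0 : 0 <= \int[P]_w (sin (h * X w) ^+ (2 * k)).
    by apply: Rintegral_ge0 => w _; exact: pow0.
  move=> /eP; rewrite cdiff_char_fun norm1_real normrM (ger0_norm sin0).
  rewrite -normrX (ger0_norm (pow0 h)); apply: le_trans.
  by rewrite ler_peMl // normrX normrN ger0_norm // exprn_ege1 // ler1n.
pose D m : set T := [set w | `|X w| <= m.+1%:R].
have mX : measurable_fun setT (fun w => (X w ^+ (2 * k))%:E).
  by apply/measurable_EFinP; apply: measurable_funX; exact: measurable_funP.
have mD m : measurable (D m).
  have -> : D m = X @^-1` `[- m.+1%:R, m.+1%:R].
    by apply/seteqP; split => w; rewrite /D /= in_itv /= ler_norml.
  by rewrite -[X in measurable X]setTI; exact: measurable_funP.
have ndD : nondecreasing_seq D.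
  move=> m n mn; apply/subsetPset => w /= /le_trans; apply.
  by rewrite ler_nat.
have UD : \bigcup_m D m = setT.
  apply/seteqP; split => // w _; exists (Num.truncn `|X w|) => //=.
  exact: ltW (truncnS_gt _).
have cvgD := ge0_nondecreasing_set_cvg_integral (mu := P) ndD mD
  (fun m => measurable_funTS mX) (fun m w _ => pow0 (X w)).
rewrite UD in cvgD.
(* The power of 4/h that compares X with sin(h X) cancels the h^(2k) from [sinC], so the bound does
   not depend on [m] and survives monotone convergence. *)
have bound m : (m.+1%:R)^-1 < e ->
    (\int[P]_(w in D m) (X w ^+ (2 * k))%:E <= (4 ^+ (2 * k) * C)%:E)%E.
  set h : R := (m.+1%:R)^-1 => he.
  have h0 : 0 < h by rewrite invr_gt0.
  pose s w : R := (4 / h) ^+ (2 * k) * sin (h * X w) ^+ (2 * k).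
  have sint : P.-integrable setT (EFin \o s).
    exact/integrableZl_EFin/integrable_sinX.
  have s0 w : 0 <= s w by rewrite mulr_ge0.
  apply: (@le_trans _ _ (\int[P]_(w in D m) (s w)%:E)%E).
    apply: ge0_le_integral => //.
    - by move=> w _; rewrite lee_fin.
    - exact: measurable_funTS mX.
    - exact: measurable_funTS (measurable_int _ sint).
    move=> w Dw; rewrite lee_fin /s -exprMn !exprM lerXn2r ?nnegrE ?sqr_ge0 //.
    rewrite -(real_normK (num_real (X w))).
    rewrite -(real_normK (num_real (4 / h * _))) lerXn2r ?nnegrE //.
    have : `|h * X w| <= pi / 2.
      apply: le_trans (_ : 1 <= _); last by rewrite pihalf_ge1.
      by rewrite normrM gtr0_norm // mulrC ler_pdivrMr // mul1r.
    move=> /norm_sin_ge sin_ge.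
    have h4 : 0 <= 4 / h by rewrite divr_ge0 // ltW.
    have -> : `|X w| = 4 / h * (`|h * X w| / 4).
      by rewrite normrM (gtr0_norm h0); field; rewrite gt_eqF.
    by rewrite [leRHS]normrM (ger0_norm h4) ler_wpM2l.
  apply: (@le_trans _ _ (\int[P]_w (s w)%:E)%E).
    apply: ge0_subset_integral => //; first exact: measurable_int sint.
    by move=> w _; rewrite lee_fin.
  rewrite -[leLHS]fineK ?integrable_fin_num // lee_fin.
  rewrite -/(Rintegral P setT s) RintegralZl //; last exact: integrable_sinX.
  apply: le_trans (ler_wpM2l (pow0 _) (sinC h _)) _; first by rewrite gtr0_norm.
  by rewrite mulrCA -exprMn divfK ?gt_eqF // mulrC.
apply/integrableP; split => //.
apply: (@le_lt_trans _ _ (4 ^+ (2 * k) * C)%:E); last exact: ltry.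
under eq_integral do rewrite gee0_abs ?lee_fin //.
rewrite -(cvg_lim _ cvgD) //; apply: lime_le.
  by apply/cvg_ex; eexists; exact: cvgD.
near=> m; apply: bound; near: m; exact: near_infty_natSinv_lt (PosNum e0).
Unshelve. all: by end_near. Qed.

(** Domination by even moments: |x|^n <= 1 + x^(2n), which comes from (|x|^n - 1)^2 >= 0. *)
Lemma integrable_moment :
  (forall k, bigO (2 * k) (cdiff (2 * k) (char_fun X))) ->
  forall n, P.-integrable setT (fun w => (X w ^+ n)%:E).
Proof.
move=> XO n; have i2 := integrable_even_moment (XO n).
have i1 : P.-integrable setT (fun _ : T => (1 : R)%:E).
  by apply: finite_measure_integrable_cst.
apply: le_integrable (integrableD measurableT i1 i2) => //.
  by apply/measurable_EFinP; apply: measurable_funX; exact: measurable_funP.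
move=> w _ /=; rewrite lee_fin normrX.
rewrite (ger0_norm (_ : 0 <= 1 + X w ^+ (2 * n))); last first.
  by rewrite addr_ge0 // exprM exprn_ge0 // sqr_ge0.
rewrite mulnC exprM -(real_normK (num_real (X w ^+ n))) normrX.
by have := sqr_ge0 (`|X w| ^+ n - 1); have := sqr_ge0 (`|X w| ^+ n); nra.
Qed.

End CharFun.

(** * The Maxwell-Boltzmann moments *)

Section MomentSeries.
Context {R : realType}.
Implicit Types (mu : probability R R) (t : R) (n j : nat).

Lemma moment0 mu : moment mu 0 = 1.
Proof.
rewrite /moment; under eq_Rintegral do rewrite expr0.
rewrite Rintegral_cst // mul1r -[RHS]/(fine 1%E); congr fine.
exact: probability_setT.
Qed.

(** Subtracting 1 removes the constant term, as the zeroth moment is 1. Distributing the [j]-th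
    power then gives a sum over [j] exponents in {1, ..., n}, and the coefficient of X^n selects
    those with sum [n]; their powers of i combine to i^n. *)
Lemma coef_moment_poly_sub1_exp mu n j :
  ((moment_poly n.+1 (moment mu) - 1) ^+ j)`_n =
  'i%C ^+ n * (\sum_(k : {ffun 'I_j -> 'I_n} | (\sum_i (k i).+1 == n)%N)
    (\prod_i (k i).+1`!)%N%:R^-1 * \prod_i moment mu (k i).+1)%:C.
Proof.
pose c m : R[i] := m`!%:R^-1 * 'i%C ^+ m * (moment mu m)%:C.
have -> : moment_poly n.+1 (moment mu) - 1 = \sum_(m < n) c m.+1 *: 'X^(m.+1).
  rewrite /moment_poly poly_def big_ord_recl fact0 invr1 mul1r expr0 mul1r.
  rewrite moment0 scale1r addrAC subrr add0r.
  by apply: eq_bigr => m _.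
rewrite -[j in _ ^+ j]card_ord -prodr_const bigA_distr_bigA coef_sum.
rewrite rmorph_sum mulr_sumr [RHS]big_mkcond; apply: eq_bigr => k _ /=.
rewrite scaler_prod -expr_sum coefZ coefXn eq_sym.
case: eqP => [kn|_]; last by rewrite mulr0.
rewrite mulr1 natr_prod rmorphM fmorphV !rmorph_prod -prodfV.
under [X in _ = _ * (X * _)]eq_bigr do rewrite rmorph_nat.
by rewrite /c [in LHS]big_split [in LHS]big_split -expr_sum kn mulrCA mulrA.
Qed.

Lemma coef_binom_moment_poly mu t n : (0 < n)%N ->
  (binom_poly n.+1 t \Po moment_poly n.+1 (moment mu))`_n =
  n`!%:R^-1 * 'i%C ^+ n * (maxwell_boltzmann mu t n)%:C.
Proof.
move=> n0; rewrite /binom_poly linear_sum coef_sum /=.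
rewrite -(big_mkord xpredT (fun j => ((gbinom t j)%:C *: ('X - 1) ^+ j
  \Po moment_poly n.+1 (moment mu))`_n)) big_ltn //.
(* The term [j = 0] is constant and does not reach the coefficient of positive index [n]; this
   matches the sum over j >= 1 in [maxwell_boltzmann]. *)
rewrite expr0 comp_polyZ rmorph1 coefZ coef1 gtn_eqF // mulr0 add0r.
rewrite /maxwell_boltzmann rmorph_sum mulr_sumr; apply: eq_bigr => j _ /=.
rewrite comp_polyZ rmorphXn rmorphB rmorph1 /= comp_polyX coefZ.
rewrite coef_moment_poly_sub1_exp.
under [in RHS]eq_bigr do rewrite -mulrA.
rewrite -mulr_sumr !rmorphM rmorph_nat.
by field; rewrite !pnatr_eq0 -!lt0n !fact_gt0.
Qed.

End MomentSeries.

Lemma integrable_moment_distribution (R : realType) d (T : measurableType d)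
    (P : probability T R) (X : {RV P >-> R}) :
  all_moments_finite (distribution P X) ->
  forall n, P.-integrable setT (fun w => (X w ^+ n)%:E).
Proof.
move=> Xint n; have /integrableP[mX iX] := Xint n.
apply/integrableP; split.
  by apply/measurable_EFinP; apply: measurable_funX; exact: measurable_funP.
move: iX; rewrite ge0_integral_distribution //.
exact: measurableT_comp.
Qed.

Lemma moment_distribution (R : realType) d (T : measurableType d)
    (P : probability T R) (X : {RV P >-> R}) n :
  P.-integrable setT (fun w => (X w ^+ n)%:E) ->
  moment (distribution P X) n = \int[P]_w (X w ^+ n).
Proof.
move=> Xint; rewrite /moment /Rintegral integral_distribution //.
by apply/measurable_EFinP; exact: measurable_funX.
Qed.

Theorem theorem2p5 (R : realType)
    (d : measure_display) (Omega : measurableType d) (P : probability Omega R)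
    (Y : {RV P >-> R}) (a : R)
    (nu : {measure set R -> \bar R})
    (Y_infdiv : infinitely_divisible (distribution P Y))
    (Y_moments : all_moments_finite (distribution P Y))
    (nu_integrable : forall theta : R,
       cintegrable nu `]0, +oo[ (fun z : R => cexp ('i%C * (theta * z)%:C) - 1))
    (Y_char : forall theta : R,
       char_fun Y theta = cexp (levy_exponent a nu theta))
    (t : R) (t_ge0 : 0 <= t)
    (d' : measure_display) (Omega' : measurableType d')
    (P' : probability Omega' R) (Yt : {RV P' >-> R})
    (Yt_char : forall theta : R,
       char_fun Yt theta = cexp (t%:C * levy_exponent a nu theta))
    (n : nat) (n_ge1 : (1 <= n)%N) :
  'E_P'[fun w => (Yt w ^+ n)%R]%E = (maxwell_boltzmann (distribution P Y) t n)%:E.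
Proof.
pose psi := levy_exponent a nu; pose mu := distribution P Y.
have Yint := integrable_moment_distribution Y_moments.
have phiO N : bigO N (fun x =>
    cexp (psi x) - (moment_poly N (moment mu)).[x%:C]).
  apply: eq_bigO (bigO_char_fun N Yint) => x; rewrite Y_char.
  congr (_ - (moment_poly N _).[_]).
  by apply/funext => m; rewrite moment_distribution.
(* The expansion at order 1 has only the constant term 1, so it says that exp psi - 1 is O(x). *)
have psiO : bigO 1 psi.
  apply: bigO_of_cexp; first exact: levy_exponent_double.
  apply: eq_bigO (phiO 1) => x; rewrite horner_poly big_ord1 moment0 fact0.
  by rewrite invr1 !expr0 !mulr1.
have YtO N : bigO N (fun x => char_fun Yt x
    - (binom_poly N t \Po moment_poly N (moment mu)).[x%:C]).
  have cO := bigO0_cexp psiO.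
  have mO := bigO_horner (moment_poly N (moment mu)) (bigOW (leq0n 1) bigO_id).
  have BO := bigOB_horner (binom_poly N t) cO mO (phiO N).
  apply: eq_bigO (bigOD (bigO_cexp_binom N t psiO) BO) => x.
  by rewrite Yt_char horner_comp addrA subrK.
have Ytint := integrable_moment (fun k => bigO_cdiff (YtO (2 * k)%N)).
(* Two expansions of the characteristic function of [Yt] are compared; order [n.+1] is what reaches
   the coefficient of index [n]. *)
have coefE : bigO n.+1 (fun x => (binom_poly n.+1 t \Po
    moment_poly n.+1 (moment mu)
    - moment_poly n.+1 (fun m => \int[P']_w (Yt w ^+ m))).[x%:C]).
  apply: eq_bigO (bigOB (bigO_char_fun n.+1 Ytint) (YtO n.+1)) => x.
  by rewrite hornerD hornerN; ring.
have := bigO_coef0 coefE (ltnSn n).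
rewrite coefB coef_binom_moment_poly // coef_poly ltnSn => /eqP.
(* Both coefficients carry the nonzero factor i^n / n!, which is cancelled. *)
rewrite subr_eq0 => /eqP /mulfI E.
rewrite unlock -/mu (complexI (E _)); last first.
  rewrite mulf_neq0 ?invr_eq0 ?pnatr_eq0 -?lt0n ?fact_gt0 // expf_neq0 //.
  by rewrite eq_complex /= oner_eq0 andbF.
(* Integrability of the [n]-th power of [Yt] makes its expectation finite, so [fine] loses
   nothing. *)
by rewrite fineK ?integrable_fin_num.
Qed.
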